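(* Let $p\ge 1$ and $k\ge 0$ be integers. Consider the system of $p^2$ linear equations in $p^2$ unknowns $F(a,b)\in\mathbb{R}[[x]]$, indexed by $(a,b)\in[p]\times[p]$, $$F(a,b)=x\left(\sum_{i\in[p],\ i\le k+2b-a}F(b,i)\right)+x^2 .$$ This system has a unique solution in $\mathbb{R}[[x]]$, and the solution is $F(a,b)=\sum_{n\ge 2}f_n(a,b)x^n$. Consequently the generating function by length of the locally convex words on $[p]$ with parameter $k$ (words of length $0$ and $1$ included) is $$G_{k,p}=1+px+\sum_{a,b\in[p]}F(a,b).$$
   Context: $[n]=\{1,2,\ldots,n\}$. A word of length $n$ on the alphabet $[p]$ is a function $f:[n]\to[p]$; it is locally convex with parameter $k$ if $f(i-1)+f(i+1)-2f(i)\le k$ for all $i\in\{2,\ldots,n-1\}$ (a vacuous condition for $n\le 2$). For $n\ge 2$ and $a,b\in[p]$, $f_n(a,b)$ denotes the number of locally convex words $f:[n]\to[p]$ with parameter $k$ such that $f(1)=a$ and $f(2)=b$. $\mathbb{R}[[x]]$ is the ring of formal power series. *)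

(* Defs.v *)
From HB Require Import structures.
From mathcomp Require Import all_boot all_order all_algebra.
From mathcomp Require Import boolp reals.

Set Implicit Arguments.
Unset Strict Implicit.
Unset Printing Implicit Defensive.

Import Order.TTheory GRing.Theory Num.Theory.
Local Open Scope ring_scope.

(* [fps R] is R[[x]]. It is a record rather than an alias of [nat -> R] so that
   it carries the Cauchy product and not the pointwise ring structure. *)
Record fps (R : Type) := Fps { fps_coef : nat -> R }.

HB.instance Definition _ (R : Type) := gen_eqMixin (fps R).
HB.instance Definition _ (R : Type) := gen_choiceMixin (fps R).

Lemma fpsP (R : Type) (f g : fps R) :
  (forall n, fps_coef f n = fps_coef g n) -> f = g.
Proof. by case: f g => [f] [g] /= fg; congr Fps; apply/funext. Qed.

Definition fps_zero (R : nmodType) : fps R := Fps (fun=> 0).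
Definition fps_opp (R : zmodType) (f : fps R) : fps R :=
  Fps (fun n => - fps_coef f n).
Definition fps_add (R : nmodType) (f g : fps R) : fps R :=
  Fps (fun n => fps_coef f n + fps_coef g n).

Lemma fps_addA (R : zmodType) : associative (@fps_add R).
Proof. by move=> f g h; apply: fpsP => n /=; rewrite addrA. Qed.
Lemma fps_addC (R : zmodType) : commutative (@fps_add R).
Proof. by move=> f g; apply: fpsP => n /=; rewrite addrC. Qed.
Lemma fps_add0 (R : zmodType) : left_id (fps_zero R) (@fps_add R).
Proof. by move=> f; apply: fpsP => n /=; rewrite add0r. Qed.
Lemma fps_addN (R : zmodType) :
  left_inverse (fps_zero R) (@fps_opp R) (@fps_add R).
Proof. by move=> f; apply: fpsP => n /=; rewrite addNr. Qed.

HB.instance Definition _ (R : zmodType) := GRing.isZmodule.Build (fps R)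
  (@fps_addA R) (@fps_addC R) (@fps_add0 R) (@fps_addN R).

Definition fps_one (R : nzRingType) : fps R := Fps (fun n => (n == 0%N)%:R).
Definition fps_mul (R : nzRingType) (f g : fps R) : fps R :=
  Fps (fun n => \sum_(i < n.+1) fps_coef f i * fps_coef g (n - i)).

Definition fps_trunc (R : nzRingType) (n : nat) (f : fps R) : {poly R} :=
  \poly_(i < n) fps_coef f i.

Lemma fps_mul_poly (R : nzRingType) (f g : fps R) (p q : {poly R}) (n : nat) :
    (forall i, (i <= n)%N -> p`_i = fps_coef f i) ->
    (forall i, (i <= n)%N -> q`_i = fps_coef g i) ->
  forall i, (i <= n)%N -> (p * q)`_i = fps_coef (fps_mul f g) i.
Proof.
move=> pf qg i lein; rewrite coefM /=; apply: eq_bigr => j _.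
by rewrite pf ?qg // (leq_trans _ lein) ?leq_subr // -ltnS.
Qed.

Lemma fps_truncE (R : nzRingType) (f : fps R) (n i : nat) :
  (i <= n)%N -> (fps_trunc n.+1 f)`_i = fps_coef f i.
Proof. by rewrite -ltnS coef_poly => ->. Qed.

Lemma fps_mulA (R : comNzRingType) : associative (@fps_mul R).
Proof.
move=> f g h; apply: fpsP => n.
have E u := @fps_truncE R u n.
rewrite -(fps_mul_poly (E f) (fps_mul_poly (E g) (E h)) (leqnn n)) mulrA.
exact: fps_mul_poly (fps_mul_poly (E f) (E g)) (E h) _ (leqnn n).
Qed.

Lemma fps_mulC (R : comNzRingType) : commutative (@fps_mul R).
Proof.
move=> f g; apply: fpsP => n; have E u := @fps_truncE R u n.
rewrite -(fps_mul_poly (E f) (E g) (leqnn n)) mulrC.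
exact: fps_mul_poly (E g) (E f) _ (leqnn n).
Qed.

Lemma fps_mul1 (R : comNzRingType) : left_id (fps_one R) (@fps_mul R).
Proof.
move=> f; apply: fpsP => n /=.
rewrite big_ord_recl /= mul1r subn0 big1 ?addr0 // => i _.
by rewrite mul0r.
Qed.

Lemma fps_mulDl (R : comNzRingType) :
  left_distributive (@fps_mul R) (@fps_add R).
Proof.
move=> f g h; apply: fpsP => n /=; rewrite -big_split /=.
by apply: eq_bigr => i _; rewrite mulrDl.
Qed.

Lemma fps_one_neq0 (R : comNzRingType) : fps_one R != 0.
Proof.
by apply/eqP => /(congr1 (fun f => fps_coef f 0)) /= /eqP; rewrite oner_eq0.
Qed.

HB.instance Definition _ (R : comNzRingType) :=
  GRing.Zmodule_isComNzRing.Build (fps R) (@fps_mulA R) (@fps_mulC R)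
    (@fps_mul1 R) (@fps_mulDl R) (@fps_one_neq0 R).

Definition fpsX (R : nzRingType) : fps R := Fps (fun n => (n == 1%N)%:R).

(* The alphabet [p] = {1, ..., p} is ['I_p], which starts at 0; [letter a] is the
   element of {1, ..., p} that [a] stands for. Likewise, position i of a word of
   length n is the ordinal of value i - 1 in ['I_n]. *)
Definition letter (p : nat) (a : 'I_p) : int := (a.+1)%:Z.

(* [h], [i], [j] are consecutive positions, i.e. i - 1, i, i + 1. *)
Definition locally_convex (k n p : nat) (f : {ffun 'I_n -> 'I_p}) : bool :=
  [forall h : 'I_n, forall i : 'I_n, forall j : 'I_n,
    (i == h.+1 :> nat) && (j == i.+1 :> nat) ==>
    (letter (f h) + letter (f j) - 2 * letter (f i) <= k%:Z)].

Definition lc_words (k n p : nat) : {set {ffun 'I_n -> 'I_p}} :=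
  [set f | locally_convex k f].

(* f_n(a,b); the existential quantifiers name the first and the second position,
   which exist when 2 <= n. *)
Definition lc_count (k p n : nat) (a b : 'I_p) : nat :=
  #|[set f in lc_words k n p |
      [exists i : 'I_n, (i == 0%N :> nat) && (f i == a)] &&
      [exists i : 'I_n, (i == 1%N :> nat) && (f i == b)]]|.

Definition lc_system (R : realType) (k p : nat)
    (F : {ffun 'I_p * 'I_p -> fps R}) : Prop :=
  forall a b : 'I_p,
    F (a, b) = fpsX R *
      (\sum_(i : 'I_p | letter i <= k%:Z + 2 * letter b - letter a) F (b, i))
      + fpsX R ^+ 2.

Definition lc_series (R : realType) (k p : nat) (a b : 'I_p) : fps R :=
  Fps (fun n => if (2 <= n)%N then (lc_count k n a b)%:R else 0).

Definition lc_gf (R : realType) (k p : nat) : fps R :=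
  Fps (fun n => #|lc_words k n p|%:R).

(* Main.v *)
Require Import Defs.
From mathcomp Require Import all_boot all_order all_algebra.
From mathcomp Require Import boolp reals.
From mathcomp Require Import lra.

Set Implicit Arguments.
Unset Strict Implicit.
Unset Printing Implicit Defensive.

Import Order.TTheory GRing.Theory Num.Theory.
Local Open Scope ring_scope.

(* Deleting the first letter of a word of length n + 3 beginning with a, b, i
   is a bijection onto the words of length n + 2 beginning with b, i, subject to
   the single constraint i <= k + 2b - a. Hence the counts f_n(a,b) satisfy the
   recurrence that the system expresses coefficientwise; that recurrence
   determines every coefficient from the previous ones, so the solution is
   unique. *)

(** * Coefficients of power series *)

Lemma fps_coefD (R : zmodType) (f g : fps R) n :
  fps_coef (f + g) n = fps_coef f n + fps_coef g n.
Proof. by []. Qed.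

Lemma fps_coef_sum (R : zmodType) (I : Type) (r : seq I) (P : pred I)
    (F : I -> fps R) n :
  fps_coef (\sum_(i <- r | P i) F i) n = \sum_(i <- r | P i) fps_coef (F i) n.
Proof.
exact: (big_morph (fun f : fps R => fps_coef f n) (fun f g => fps_coefD f g n)).
Qed.

Lemma fps_coefXM0 (R : comNzRingType) (f : fps R) :
  fps_coef (fpsX R * f) 0 = 0.
Proof. by rewrite /= big_ord1 mul0r. Qed.

Lemma fps_coefXMS (R : comNzRingType) (f : fps R) n :
  fps_coef (fpsX R * f) n.+1 = fps_coef f n.
Proof.
rewrite /= big_ord_recl mul0r add0r big_ord_recl mul1r /= subSS subn0.
by rewrite big1 ?addr0 // => i _; rewrite mul0r.
Qed.

Lemma fps_coefX2 (R : comNzRingType) n :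
  fps_coef (fpsX R ^+ 2) n = (n == 2)%:R.
Proof. by rewrite expr2; case: n => [|n]; rewrite ?fps_coefXM0 ?fps_coefXMS. Qed.

Lemma fps_coef_nat (R : comNzRingType) m n :
  fps_coef (m%:R : fps R) n = (m * (n == 0))%:R.
Proof.
elim: m => [|m IHm] //.
by rewrite -addn1 natrD /= IHm -natrD mulnDl mul1n.
Qed.

(** * Counting words by their first two letters *)

Section Words.
Variables (k p : nat).

Definition word_cons n (a : 'I_p) (g : {ffun 'I_n -> 'I_p}) :
    {ffun 'I_n.+1 -> 'I_p} :=
  [ffun i => if unlift ord0 i is Some j then g j else a].

Lemma word_cons0 n a (g : {ffun 'I_n -> 'I_p}) : word_cons a g ord0 = a.
Proof. by rewrite ffunE unlift_none. Qed.

Lemma word_consS n a (g : {ffun 'I_n -> 'I_p}) i :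
  word_cons a g (lift ord0 i) = g i.
Proof. by rewrite ffunE liftK. Qed.

Lemma word_cons_inj n a : injective (@word_cons n a).
Proof.
by move=> g h /ffunP gh; apply/ffunP => i; rewrite -(word_consS a g) gh word_consS.
Qed.

Lemma word_consE n (f : {ffun 'I_n.+1 -> 'I_p}) :
  f = word_cons (f ord0) [ffun i => f (lift ord0 i)].
Proof.
apply/ffunP => i; rewrite ffunE.
by case: unliftP => [j|] ->; rewrite ?ffunE.
Qed.

(** Prepending a letter shifts every triple of consecutive positions of [g] by one and creates a
    single new triple, the initial one. Length at least 2 for [g] ensures that this triple
    exists. *)
Lemma locally_convex_cons n a (g : {ffun 'I_n.+2 -> 'I_p}) :
  locally_convex k (word_cons a g) =
    (letter (g (lift ord0 ord0)) <= k%:Z + 2 * letter (g ord0) - letter a)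
    && locally_convex k g.
Proof.
have E (x y z : int) : (x + y - 2 * z <= k%:Z) = (y <= k%:Z + 2 * z - x).
  by apply/idP/idP; lra.
rewrite -E; apply/idP/andP => [gP|[a_g gP]].
  split.
    move: gP => /forallP/(_ ord0)/forallP/(_ (lift ord0 ord0)).
    move=> /forallP/(_ (lift ord0 (lift ord0 ord0)))/implyP.
    by rewrite word_cons0 !word_consS; apply.
  apply/forallP => h; apply/forallP => i; apply/forallP => j.
  move: gP => /forallP/(_ (lift ord0 h))/forallP/(_ (lift ord0 i)).
  by move=> /forallP/(_ (lift ord0 j)); rewrite !word_consS !lift0 !eqSS.
apply/forallP => h; apply/forallP => i; apply/forallP => j; apply/implyP.
(* Neither [i] nor [j] can be the first position, as each is a successor. If [h] is not first
   either, the triple lies inside [g]; otherwise it is the initial triple. *)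
have [i' ->|->] := unliftP ord0 i; last by [].
have [j' ->|->] := unliftP ord0 j; last by rewrite lift0 => /andP[].
rewrite !lift0 !eqSS !word_consS.
have [h' ->|->] := unliftP ord0 h.
  rewrite lift0 word_consS.
  by move: gP => /forallP/(_ h')/forallP/(_ i')/forallP/(_ j')/implyP.
rewrite word_cons0 => /andP[/eqP i0 /eqP j1].
have -> : i' = ord0 by exact: val_inj.
have -> // : j' = lift ord0 ord0 by apply: val_inj; rewrite /= j1 i0.
Qed.

Lemma locally_convex_small n (f : {ffun 'I_n -> 'I_p}) :
  (n <= 2)%N -> locally_convex k f.
Proof.
move=> n2; apply/forallP => h; apply/forallP => i; apply/forallP => j.
apply/implyP => /andP[/eqP ih /eqP ji].
by have := leq_trans (ltn_ord j) n2; rewrite ji ih.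
Qed.

(** From length 2 on, the first two positions exist, so the existentials become evaluations. Pairing
    the two letters matches the map used to partition the words in [card_lc_words]. *)
Lemma lc_countE n (a b : 'I_p) :
  lc_count k n.+2 a b =
  #|[set f in lc_words k n.+2 p | (f ord0, f (lift ord0 ord0)) == (a, b)]|.
Proof.
congr #|pred_of_set _|; apply/setP => f; rewrite !inE xpair_eqE.
congr [&& _, _ & _]; apply/existsP/idP => [[i /andP[/eqP i0]]|fP].
- by rewrite (_ : i = ord0) //; exact: val_inj.
- by exists ord0; rewrite eqxx.
- by rewrite (_ : i = lift ord0 ord0) //; exact: val_inj.
- by exists (lift ord0 ord0); rewrite lift0 eqxx.
Qed.

Lemma card_lc_words n :
  #|lc_words k n.+2 p| = \sum_(a : 'I_p) \sum_(b : 'I_p) lc_count k n.+2 a b.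
Proof.
rewrite pair_big -sum1_card /=.
rewrite (partition_big (fun f : {ffun 'I_n.+2 -> 'I_p} =>
  (f ord0, f (lift ord0 ord0))) predT) //=.
apply: eq_bigr => -[a b] _; rewrite lc_countE -sum1_card /=.
by apply: eq_bigl => f; rewrite !inE.
Qed.

Lemma lc_count2 (a b : 'I_p) : lc_count k 2 a b = 1%N.
Proof.
rewrite lc_countE; apply/eqP/cards1P.
exists (word_cons a [ffun=> b]); apply/setP => f.
rewrite !inE locally_convex_small //= xpair_eqE.
apply/andP/eqP => [[/eqP <- /eqP <-]|->]; last first.
  by rewrite word_cons0 word_consS ffunE !eqxx.
rewrite [LHS]word_consE; congr word_cons.
by apply/ffunP => i; rewrite !ffunE (ord1 i).
Qed.

Lemma lc_count_rec n (a b : 'I_p) :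
  lc_count k n.+3 a b =
  \sum_(i : 'I_p | letter i <= k%:Z + 2 * letter b - letter a)
    lc_count k n.+2 b i.
Proof.
(* [T] is the set of tails: prepending [a] maps it bijectively onto the words counted on the
   left. *)
pose T := [set g in lc_words k n.+2 p | (g ord0 == b) &&
  (letter (g (lift ord0 ord0)) <= k%:Z + 2 * letter b - letter a)].
transitivity #|T|.
  rewrite lc_countE -[RHS](card_imset _ (@word_cons_inj _ a)).
  apply: eq_card => f; rewrite !inE.
  apply/idP/imsetP => [|[g gT ->]].
    rewrite xpair_eqE [f]word_consE word_cons0 word_consS locally_convex_cons.
    move=> /andP[/andP[cond fP] /andP[/eqP fa /eqP fb]].
    exists [ffun i => f (lift ord0 i)]; last by rewrite {1}fa.
    by rewrite !inE fP -fb -fa eqxx.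
  move: gT; rewrite !inE locally_convex_cons word_cons0 word_consS.
  by move=> /andP[-> /andP[/eqP -> ->]]; rewrite eqxx.
(* Split [T] by the second letter [i] of the tail. For admissible [i] the inequality in [T] holds
   automatically, so the fibre is counted by [lc_count k n.+2 b i]. *)
rewrite -sum1_card (partition_big (fun g : {ffun 'I_n.+2 -> 'I_p} =>
  g (lift ord0 ord0)) (fun i => letter i <= k%:Z + 2 * letter b - letter a)).
  apply: eq_bigr => i ci; rewrite lc_countE -sum1_card /=.
  apply: eq_bigl => g; rewrite !inE xpair_eqE -!andbA.
  by have [->|_] := eqVneq (g (lift ord0 ord0)) i; rewrite ?ci ?andbF.
by move=> g; rewrite !inE => /and3P[].
Qed.

End Words.

(** * The system and the generating function *)

Lemma lc_system_coefS (R : realType) k p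
    (F : {ffun 'I_p * 'I_p -> fps R}) a b n :
  lc_system k F -> fps_coef (F (a, b)) n.+1 =
    \sum_(i : 'I_p | letter i <= k%:Z + 2 * letter b - letter a)
      fps_coef (F (b, i)) n + (n == 1)%:R.
Proof.
by move=> ->; rewrite fps_coefD fps_coefXMS fps_coefX2 fps_coef_sum.
Qed.

Lemma lc_system_inj (R : realType) k p (F G : {ffun 'I_p * 'I_p -> fps R}) :
  lc_system k F -> lc_system k G -> F = G.
Proof.
move=> FP GP; apply/ffunP => -[a b]; apply: fpsP => n.
(* The pair must vary in the induction: the next coefficient of [F (a, b)] involves those of
   [F (b, i)]. *)
elim: n a b => [|n IHn] a b.
  have coef0 H : lc_system k H -> fps_coef (H (a, b)) 0 = 0 :> R.
    by move=> ->; rewrite fps_coefD fps_coefXM0 fps_coefX2 addr0.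
  by rewrite !coef0.
rewrite !(lc_system_coefS _ _ _ FP, lc_system_coefS _ _ _ GP).
by congr (_ + _); apply: eq_bigr => i _; apply: IHn.
Qed.

Lemma lc_series_system (R : realType) k p :
  lc_system k [ffun ab : 'I_p * 'I_p => lc_series R k ab.1 ab.2].
Proof.
move=> a b; apply: fpsP => n; rewrite ffunE fps_coefD fps_coefX2.
case: n => [|n]; first by rewrite fps_coefXM0 addr0.
rewrite fps_coefXMS fps_coef_sum; under eq_bigr do rewrite ffunE /=.
(* Exponent 1 has only zero terms; at exponent 2 the term [x^2] accounts for the single word [ab];
   beyond, the recurrence applies. *)
case: n => [|[|n]] /=; first by rewrite big1 // addr0.
  by rewrite lc_count2 big1 // add0r.
by rewrite lc_count_rec natr_sum addr0.
Qed.

Lemma lc_gfE (R : realType) k p :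
  lc_gf R k p = 1 + p%:R * fpsX R +
    \sum_(a : 'I_p) \sum_(b : 'I_p) lc_series R k a b.
Proof.
apply: fpsP => n.
rewrite !fps_coefD [_ * fpsX R]mulrC fps_coef_sum; under eq_bigr do rewrite fps_coef_sum.
(* Short words are all locally convex; lengths 0 and 1 yield the terms 1 and [p x]. *)
have lcT m : (m <= 2)%N -> #|lc_words k m p| = (p ^ m)%N.
  move=> m2; rewrite -[RHS](_ : #|{ffun 'I_m -> 'I_p}| = _).
    by apply: eq_card => f; rewrite !inE locally_convex_small.
  by rewrite card_ffun !card_ord.
case: n => [|n].
  by rewrite fps_coefXM0 /= lcT // big1 ?addr0 // => *; rewrite big1.
rewrite fps_coefXMS fps_coef_nat; case: n => [|n] /=.
  by rewrite lcT // muln1 add0r big1 ?addr0 // => *; rewrite big1.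
rewrite muln0 !add0r card_lc_words natr_sum.
by apply: eq_bigr => a _; rewrite natr_sum.
Qed.

Theorem mainTheorem2 (R : realType) (k p : nat) (hp : (1 <= p)%N) :
  exists F : {ffun 'I_p * 'I_p -> fps R},
    [/\ unique (@lc_system R k p) F,
        forall a b : 'I_p, F (a, b) = lc_series R k a b
      & lc_gf R k p =
          1 + p%:R * fpsX R + \sum_(a : 'I_p) \sum_(b : 'I_p) F (a, b)].
Proof.
exists [ffun ab => lc_series R k ab.1 ab.2]; split.
- split; first exact: lc_series_system.
  by move=> G; apply: lc_system_inj; exact: lc_series_system.
- by move=> a b; rewrite ffunE.
- rewrite lc_gfE; congr (_ + _).
  by apply: eq_bigr => a _; apply: eq_bigr => b _; rewrite ffunE.
Qed.
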